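(* For every integer $\ell \ge 0$, there exists a sequence of $(\ell+3,\ell)$-stable graphs $G_m$ with vertex sets $V_m$ such that $|V_m| \to \infty$ as $m \to \infty$ and $$\alpha(G_m) = \frac{|V_m|}{2} - O\left(\sqrt{|V_m|}\right).$$
   Context: All graphs are finite, undirected, and simple. $\alpha(G)$ denotes the independence number of $G$. For vertices $v_1,\ldots,v_k$ of $G$, $G \setminus \{v_1,\ldots,v_k\}$ denotes the induced subgraph of $G$ on $V(G)\setminus\{v_1,\ldots,v_k\}$. For integers $k > \ell \ge 0$, a graph $G$ (with at least $k$ vertices) is called $(k,\ell)$-stable if for every $k$ vertices $v_1,\ldots,v_k$ of $G$, $\alpha(G\setminus\{v_1,\ldots,v_k\}) \ge \alpha(G) - \ell$. The $O$-notation is as $m \to \infty$ for fixed $\ell$: there is a constant $C$ (which may depend on $\ell$ but not on $m$) such that $\left|\alpha(G_m) - |V_m|/2\right| \le C\sqrt{|V_m|}$ for all sufficiently large $m$. *)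

(* Defs.v *)
From HB Require Import structures.
From mathcomp Require Import all_boot.

Set Implicit Arguments.
Unset Strict Implicit.
Unset Printing Implicit Defensive.

Record sgraph := SGraph {
  vertex :> finType;
  edge : rel vertex;
  edge_sym : symmetric edge;
  edge_irr : irreflexive edge
}.

Section Induced.
Variables (G : sgraph) (S : {set G}).

Definition del_vertex : finType := {x : G | x \notin S}.

Definition del_edge : rel del_vertex := fun x y => edge (val x) (val y).

Lemma del_edge_sym : symmetric del_edge.
Proof. by move=> x y; apply: edge_sym. Qed.

Lemma del_edge_irr : irreflexive del_edge.
Proof. by move=> x; apply: edge_irr. Qed.

Definition del_vertices : sgraph := SGraph del_edge_sym del_edge_irr.

End Induced.

Definition independent (G : sgraph) (A : {set G}) : bool :=
  [forall x in A, forall y in A, ~~ edge x y].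

Definition alpha (G : sgraph) : nat :=
  \max_(A : {set G} | independent A) #|A|.

(* The bound is the usual alpha (G \ S) >= alpha G - l, with l moved to the   *)
(* other side because subtraction on nat is truncated.                        *)
Definition stable (k l : nat) (G : sgraph) : Prop :=
  [/\ l < k, k <= #|G| &
      forall S : {set G}, #|S| = k -> alpha G <= alpha (del_vertices S) + l].

(* Main.v *)
Require Import Defs.
From HB Require Import structures.
From mathcomp Require Import all_boot all_order all_algebra.
From mathcomp Require Import all_classical all_reals all_analysis.
From mathcomp Require Import zify ring.

Set Implicit Arguments.
Unset Strict Implicit.
Unset Printing Implicit Defensive.

Import Order.TTheory GRing.Theory Num.Theory.

(* The graph is the N x N grid, N = M + 1 odd, embedded in the projective     *)
(* plane: (0, y) is joined to (M, M - y) and (x, 0) to (M - x, M).            *)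
(*                                                                            *)
(* Upper bound alpha <= N M / 2.  Columns x and M - x together carry a closed *)
(* walk of length 2N.  If an independent set A has more than M vertices on    *)
(* it, A alternates along it, and the same holds for pairs of rows.  Both     *)
(* cannot occur, for a column pair and a row pair together contain an odd     *)
(* closed walk.  So, say, every column pair carries at most M vertices of A,  *)
(* and summing over x gives 2 |A| <= N M.                                     *)
(*                                                                            *)
(* Avoiding three vertices.  A "wall" P, a 1-Lipschitz antiperiodic height    *)
(* function on the columns whose parity alternates, cuts the projective plane *)
(* into a disc; one colour class of the disc is an independent set with M / 2 *)
(* vertices in each column.  There are four families of walls (as functions   *)
(* of x or of y, and two parities), and walls of one family are closed under  *)
(* pointwise median.  Two vertices are avoided simultaneously by some wall of *)
(* a family, except perhaps for one of the four families.  Three vertices     *)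
(* form only three pairs, so some family works for each pair, and the median  *)
(* of the three walls found for the pairs avoids all three vertices.          *)
(*                                                                            *)
(* Finally, deleting l further vertices costs at most l.                      *)

(* The distance from x to w - N in the cycle of length 2N, provided that      *)
(* 0 <= w <= 3N; the shift by N keeps w nonnegative.                          *)
Definition tent (N w x : nat) : nat :=
  let d := (x + N - w) + (w - (x + N)) in minn d (N.*2 - d).

(* The colour class in a column which the wall crosses at height P: the       *)
(* vertices P - 1 and P are left out, and parity alternates from there on.    *)
Definition chosen (P y : nat) : bool := odd (y + P) == (P <= y).

(* In a column where odd P = ~~ (odd x (+) c), avoiding (x, y) means P <= y   *)
(* if odd (x + y) (+) c, and y < P otherwise.  A conflict occurs when these   *)
(* two demands exclude each other for antiperiodic 1-Lipschitz walls.         *)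
Definition conflict M (c : bool) (x1 y1 x2 y2 : nat) : bool :=
  let d := (x1 - x2) + (x2 - x1) in
  match odd (x1 + y1) (+) c, odd (x2 + y2) (+) c with
  | true, true => y1 + y2 < d
  | false, false => M.*2 < d + y1 + y2
  | true, false => y1 + d < y2
  | false, true => y2 + d < y1
  end.

Definition conflict_in M (f : bool * bool) (x1 y1 x2 y2 : nat) : bool :=
  if f.1 then conflict M f.2 x1 y1 x2 y2 else conflict M f.2 y1 x1 y2 x2.

(** By the triangle inequality: for instance, y1 + y2 < |x1 - x2| and x1 + x2 < |y1 - y2| cannot
    both hold. *)
Lemma conflict_in_le1 M x1 y1 x2 y2 :
    x1 <= M -> y1 <= M -> x2 <= M -> y2 <= M ->
  \sum_(f : bool * bool) conflict_in M f x1 y1 x2 y2 <= 1.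
Proof.
rewrite -(pair_bigA _ (fun s c => conflict_in M (s, c) x1 y1 x2 y2 : nat)) /=.
rewrite !big_bool /conflict_in /conflict /= (addnC y1 x1) (addnC y2 x2).
case: (odd (x1 + y1)); case: (odd (x2 + y2)) => /=; lia.
Qed.

Lemma conflict_free M x1 y1 x2 y2 x3 y3 :
    x1 <= M -> y1 <= M -> x2 <= M -> y2 <= M -> x3 <= M -> y3 <= M ->
  exists f, [/\ ~~ conflict_in M f x1 y1 x2 y2, ~~ conflict_in M f x1 y1 x3 y3
    & ~~ conflict_in M f x2 y2 x3 y3].
Proof.
move=> hx1 hy1 hx2 hy2 hx3 hy3.
pose C12 f := conflict_in M f x1 y1 x2 y2.
pose C13 f := conflict_in M f x1 y1 x3 y3.
pose C23 f := conflict_in M f x2 y2 x3 y3.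
have [/existsP[f /and3P[n12 n13 n23]]|] :=
  boolP [exists f, [&& ~~ C12 f, ~~ C13 f & ~~ C23 f]]; first by exists f.
rewrite negb_exists => /forallP bad.
have : \sum_(f : bool * bool) 1 <= \sum_f (C12 f + C13 f + C23 f).
  apply: leq_sum => f _; have := bad f.
  by case: (C12 f); case: (C13 f); case: (C23 f).
rewrite !big_split /= sum1_card card_prod card_bool leqNgt => /negP[].
by rewrite ltnS -[3]/(1 + 1 + 1) !leq_add // conflict_in_le1.
Qed.

Lemma chosen_tent N w x y : odd N -> w <= 3 * N -> x < N ->
  chosen (tent N w x) y =
    if odd (x + y) (+) odd w then y < tent N w x else tent N w x <= y.
Proof.
rewrite /chosen => oN wN xN.
have -> : odd (y + tent N w x) = ~~ (odd (x + y) (+) odd w).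
  by rewrite /tent /minn; case: ltnP; lia.
by case: (_ (+) _); lia.
Qed.

Lemma avoid_pair k c x1 y1 x2 y2 (M := k.*2) (N := M.+1) :
    x1 <= M -> y1 <= M -> x2 <= M -> y2 <= M ->
    ~~ conflict M c x1 y1 x2 y2 ->
  exists w, [/\ w <= 3 * N, odd w = c, ~~ chosen (tent N w x1) y1
    & ~~ chosen (tent N w x2) y2].
Proof.
move=> h1 h2 h3 h4.
suff tentP w : w <= 3 * N -> odd w = c ->
   (if odd (x1 + y1) (+) c then tent N w x1 <= y1 else y1 < tent N w x1) ->
   (if odd (x2 + y2) (+) c then tent N w x2 <= y2 else y2 < tent N w x2) ->
   exists w, [/\ w <= 3 * N, odd w = c, ~~ chosen (tent N w x1) y1
    & ~~ chosen (tent N w x2) y2].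
  rewrite /conflict.
  (* Up to shifts by [N.*2], each demand confines [w] to an interval: [x + N - y, x + N + y] for
     height at most y, [x + N + y + 1, x + 3N - y - 1] for height above y. All endpoints have parity
     [c]; the witness is an endpoint of the intersection. *)
  case E1: (_ (+) _) tentP; case E2: (_ (+) _) => tentP hc.
  - by apply: (tentP (maxn (x1 + N - y1) (x2 + N - y2))); rewrite /tent; lia.
  - case: (leqP x1 x2) => hx.
      by apply: (tentP (maxn (x1 + N - y1) (x2 + y2 + 1 - N)));
        rewrite /tent; lia.
    by apply: (tentP (minn (x1 + N + y1) (x2 + 3 * N - y2 - 1)));
      rewrite /tent; lia.
  - case: (leqP x2 x1) => hx.
      by apply: (tentP (maxn (x2 + N - y2) (x1 + y1 + 1 - N)));
        rewrite /tent; lia.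
    by apply: (tentP (minn (x2 + N + y2) (x1 + 3 * N - y1 - 1)));
      rewrite /tent; lia.
  - by apply: (tentP (maxn (x1 + y1) (x2 + y2) + N.*2 - M)); rewrite /tent; lia.
move=> hw ow a1 a2; exists w; split=> //.
  by rewrite chosen_tent ?ow; move: a1; case: (_ (+) _); lia.
by rewrite chosen_tent ?ow; move: a2; case: (_ (+) _); lia.
Qed.

(* The last condition is the Lipschitz condition across the identification    *)
(* of column M + 1 with column 0 turned upside down, i.e., with height        *)
(* M + 1 - P 0.                                                               *)
Definition wall (M : nat) (c : bool) (P : nat -> nat) : Prop :=
  [/\ forall x, x <= M -> P x <= M.+1 /\ odd (P x) = odd x (+) c,
      forall x, x < M -> P x <= (P x.+1).+1 /\ P x.+1 <= (P x).+1
    & M <= P 0 + P M <= M.+2].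

Definition median (a b c : nat) : nat := maxn (minn a b) (minn (maxn a b) c).

Lemma wall_tent M w : ~~ odd M -> w <= 3 * M.+1 ->
  wall M (~~ odd w) (tent M.+1 w).
Proof. by move=> oM hw; split=> [x hx|x hx|]; rewrite /tent; lia. Qed.

(** Unlike a minimum or maximum, the median commutes with turning heights upside down, as the last
    condition of [wall] requires. *)
Lemma wall_median M c P1 P2 P3 : wall M c P1 -> wall M c P2 -> wall M c P3 ->
  wall M c (fun x => median (P1 x) (P2 x) (P3 x)).
Proof.
rewrite /median => -[b1 s1 e1] [b2 s2 e2] [b3 s3 e3]; split=> [x hx|x hx|].
- by move: (b1 x hx) (b2 x hx) (b3 x hx); lia.
- by move: (s1 x hx) (s2 x hx) (s3 x hx); lia.
- by lia.
Qed.

(** For a fixed parity of the height, being left out is a one-sided comparison of the height with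
    [y], which the median inherits from any two of the three. *)
Lemma chosen_median P1 P2 P3 y :
    odd P1 = odd P2 -> odd P1 = odd P3 ->
    2 <= ~~ chosen P1 y + ~~ chosen P2 y + ~~ chosen P3 y ->
  ~~ chosen (median P1 P2 P3) y.
Proof.
rewrite /chosen /median !oddD => o2 o3.
have -> : odd (maxn (minn P1 P2) (minn (maxn P1 P2) P3)) = odd P1 by lia.
by rewrite -o2 -o3; case: (_ (+) _); lia.
Qed.

(** * Independence and size of the colour classes *)

Definition step (d a b : nat) : bool := (a + d == b) || (b + d == a).

(* Within [0, M], step M a b says that {a, b} = {0, M}. *)
Definition grid_adj (M : nat) (u v : nat * nat) : bool :=
  [|| (u.1 == v.1) && step 1 u.2 v.2, (u.2 == v.2) && step 1 u.1 v.1,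
      (u.1 + v.1 == M) && step M u.2 v.2 | (u.2 + v.2 == M) && step M u.1 v.1].

Lemma grid_adj_swap M x y x' y' :
  grid_adj M (y, x) (y', x') = grid_adj M (x, y) (x', y').
Proof. by rewrite /grid_adj /=; do 4 case: (_ && _). Qed.

Lemma chosen_indep M c P x y x' y' :
    ~~ odd M -> wall M c P -> x <= M -> y <= M -> x' <= M -> y' <= M ->
    grid_adj M (x, y) (x', y') ->
  ~~ (chosen (P x) y && chosen (P x') y').
Proof.
rewrite /chosen => oM [b s e] hx hy hx' hy'.
move: (b x hx) (b x' hx') => [b1 p1] [b2 p2].
rewrite /grid_adj /step /=.
case/or4P=> /andP[/eqP e1 /orP[] /eqP e2].
- by subst; lia.
- by subst; lia.
- by rewrite addn1 in e2; subst; move: (s _ hx'); lia.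
- by rewrite addn1 in e2; subst; move: (s _ hx); lia.
- by subst; lia.
- by subst; lia.
- by have [? ?] : x = 0 /\ x' = M; [lia | clear e2; subst x x'; lia].
- by have [? ?] : x' = 0 /\ x = M; [lia | clear e2; subst x x'; lia].
Qed.

Lemma sum_odd n : \sum_(i < n) odd i = n./2.
Proof.
by elim: n => [|n IHn]; rewrite ?big_ord0 // big_ord_recr /= IHn; lia.
Qed.

Lemma sum_chosen k P : P <= k.*2.+1 -> \sum_(y < k.*2.+1) chosen P y = k.
Proof.
move=> hP; rewrite -(big_mkord xpredT (fun y => chosen P y : nat)).
(* Counted down from P - 1 and up from P, the chosen vertices are those at odd offset. *)
rewrite (big_cat_nat (n := P)) //= big_nat_rev /= big_mkord.
rewrite -[X in \sum_(X <= _ < _) _]add0n big_addn big_mkord.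
rewrite (eq_bigr (fun i : 'I_P => odd i : nat)) => [|i _]; last first.
  by have := ltn_ord i; rewrite /chosen; lia.
have oddE (i : 'I_(k.*2.+1 - P)) : chosen P (i + P) = odd i :> nat.
  by rewrite /chosen; lia.
rewrite [X in _ + X](eq_bigr _ (fun i _ => oddE i)).
by rewrite !sum_odd; lia.
Qed.

(** * Alternation along closed walks *)

Lemma cyclic_alternating T (u : nat -> bool) :
    (forall t, t < T -> ~~ (u t && u t.+1)) -> u T = u 0 ->
    T <= (\sum_(t < T) u t).*2 ->
  forall t, t <= T -> u t = u 0 (+) odd t.
Proof.
move=> u_free uT le_T.
have shift : \sum_(t < T) u t.+1 = \sum_(t < T) u t.
  case: T uT {u_free le_T} => [|T] uT; first by rewrite !big_ord0.
  by rewrite big_ord_recr big_ord_recl /= uT addnC.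
have le1 (t : 'I_T) (_ : true) : u t + u t.+1 <= 1 ?= iff (u t.+1 == ~~ u t).
  by have := u_free t (ltn_ord t); case: (u t); case: (u t.+1).
(* Cyclically each value lies in two of the T consecutive pairs, so the lower bound on the sum
   forces equality in every pair. *)
have [le_sum eq_sum] := leqif_sum le1.
rewrite big_split /= shift addnn sum1_card card_ord in le_sum eq_sum.
have /forallP alt : [forall t : 'I_T, u t.+1 == ~~ u t].
  by rewrite -eq_sum eqn_leq le_sum.
elim=> [_|t IHt lt_tT]; first by rewrite addbF.
by rewrite (eqP (alt (Ordinal lt_tT))) /= IHt 1?ltnW // addbN.
Qed.

(** The closed walk runs through [f], then [g], and back to [f 0]. As M + 1 is odd, [f y] and [g y]
    lie an odd number of steps apart, hence differ. *)
Lemma alternating_pair M (f g : nat -> bool) :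
    ~~ odd M ->
    (forall y, y < M -> ~~ (f y && f y.+1)) ->
    (forall y, y < M -> ~~ (g y && g y.+1)) ->
    ~~ (f M && g 0) -> ~~ (g M && f 0) ->
    M < \sum_(y < M.+1) f y + \sum_(y < M.+1) g y ->
  forall y, y <= M -> f y = f 0 (+) odd y /\ g y = ~~ f y.
Proof.
move=> oM ff gg fg gf lt_M.
pose u t := if t <= M then f t else if t <= M + M.+1 then g (t - M.+1) else f 0.
have uE : forall t, t <= M.+1 + M.+1 -> u t = u 0 (+) odd t.
  apply: cyclic_alternating => [t lt_t||].
  - rewrite /u; case: (ltngtP t M) => tM.
    + exact: ff.
    + have [lt_t'|le_t'] := ltnP t (M + M.+1).
        by rewrite ltnW // subSn //; apply: gg; lia.
      by rewrite (_ : t = M + M.+1) ?leqnn ?addnK //; lia.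
    + by rewrite tM leq_addl subnn.
  - by rewrite /u addSn ltnn /= leqNgt ltnS leq_addr.
  - rewrite [X in X <= _]addnn leq_double (leq_trans lt_M) // big_split_ord /=.
    apply: leq_add; apply: leq_sum => t _; have := ltn_ord t; rewrite /u ltnS.
      by move=> ->.
    move=> le_t; have [-> ->] : (M.+1 + t <= M) = false /\ M.+1 + t <= M + M.+1.
      by lia.
    by rewrite addKn.
move=> y hy; split.
  by have := uE y; rewrite /u hy; apply; lia.
have -> : f y = u y by rewrite /u hy.
have -> : g y = u (M.+1 + y).
  rewrite /u addKn; suff [-> ->] : (M.+1 + y <= M) = false /\
    M.+1 + y <= M + M.+1 by [].
  by lia.
have [le1 le2] : M.+1 + y <= M.+1 + M.+1 /\ y <= M.+1 + M.+1 by lia.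
by rewrite (uE _ le1) (uE _ le2) oddD /= (negbTE oM) addTb addbN.
Qed.

Lemma pair_sum_le (M : nat) (c : nat -> nat) :
  (forall x, x <= M -> c x + c (M - x) <= M) ->
  (\sum_(x < M.+1) c x).*2 <= M.+1 * M.
Proof.
move=> le_c; rewrite -addnn [X in _ + X](reindex_inj rev_ord_inj) /=.
rewrite -big_split /= -[in X in _ <= X](card_ord M.+1) -sum_nat_const.
by apply: leq_sum => x _; rewrite subSS le_c // -ltnS.
Qed.

(** * Independence number of the projective grid *)

Section Grid.

Variable k : nat.
Let M := k.+1.*2.

Definition grid_edge : rel ('I_k.+1.*2.+1 * 'I_k.+1.*2.+1) := fun u v =>
  grid_adj k.+1.*2 (u.1 : nat, u.2 : nat) (v.1 : nat, v.2 : nat).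

Lemma grid_edge_sym : symmetric grid_edge.
Proof. by move=> u v; rewrite /grid_edge /grid_adj /step /=; lia. Qed.

Lemma grid_edge_irr : irreflexive grid_edge.
Proof. by move=> u; rewrite /grid_edge /grid_adj /step /=; lia. Qed.

Definition pgrid : sgraph := SGraph grid_edge_sym grid_edge_irr.

Lemma card_pgrid : #|pgrid| = M.+1 ^ 2.
Proof. by rewrite card_prod card_ord mulnn. Qed.

Lemma card_grid (a : nat -> nat -> bool) :
  #|[set v : pgrid | a v.1 v.2]| = \sum_(x < M.+1) \sum_(y < M.+1) a x y.
Proof.
rewrite pair_big /= -sum1dep_card big_mkcond /=.
by apply: eq_bigr => v _; case: (a _ _).
Qed.

Lemma alpha_pgrid_le : (alpha pgrid).*2 <= M.+1 * M.
Proof.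
suff le_indep (A : {set pgrid}) : independent A -> #|A|.*2 <= M.+1 * M.
  apply: (big_ind (fun m => m.*2 <= M.+1 * M)) => // m n le_m le_n.
  by rewrite /maxn; case: ltnP.
move=> indepA.
pose a x y := ((inord x, inord y) : pgrid) \in A.
have cardA : #|A| = \sum_(x < M.+1) \sum_(y < M.+1) a x y.
  rewrite -card_grid; apply: eq_card => -[x y]; rewrite inE /a /=.
  by rewrite !inord_val.
have free x y x' y' : x <= M -> y <= M -> x' <= M -> y' <= M ->
    grid_adj M (x, y) (x', y') -> ~~ (a x y && a x' y').
  move=> hx hy hx' hy' adj; apply/andP=> -[ax ax'].
  have /forallP/(_ _)/implyP/(_ ax)/forallP/(_ _)/implyP/(_ ax') := indepA.
  by rewrite /= /grid_edge /= !inordK ?ltnS // adj.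
have oM : ~~ odd M by rewrite odd_double.
pose col x := \sum_(y < M.+1) a x y; pose row y := \sum_(x < M.+1) a x y.
have [/forallP col_le|] := boolP [forall x : 'I_M.+1, col x + col (M - x) <= M].
  rewrite cardA; apply: (pair_sum_le (c := col)) => x hx.
  exact: (col_le (Ordinal (hx : x < M.+1))).
rewrite negb_forall => /existsP[[x0 /= hx0]]; rewrite -ltnNge => col_gt.
rewrite cardA exchange_big; apply: (pair_sum_le (c := row)) => y0 hy0.
rewrite leqNgt; apply/negP=> row_gt.
rewrite ltnS in hx0.
have colE y : y <= M -> a x0 y = a x0 0 (+) odd y.
  case/(alternating_pair oM _ _ _ _ col_gt)=> // [t ht|t ht||];
    by apply: free; rewrite ?leq_subr // /grid_adj /step /=; lia.
have rowE x : x <= M -> a x (M - y0) = ~~ a x y0.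
  case/(alternating_pair (f := fun t => a t y0) (g := fun t => a t (M - y0))
            oM _ _ _ _ row_gt)=> // [t ht|t ht||];
    by apply: free; rewrite ?leq_subr // /grid_adj /step /=; lia.
(* Since M is even, [y0] and [M - y0] have the same parity, so alternation along column [x0] makes
   these two vertices agree, against [rowE]. *)
have := rowE x0 hx0; rewrite (colE (M - y0)) ?leq_subr // (colE y0) //.
rewrite oddB // (negbTE oM) addFb.
by case: (_ (+) _).
Qed.

Lemma wall_indep c P : wall M c P ->
  independent [set v : pgrid | chosen (P v.1) v.2]
    /\ independent [set v : pgrid | chosen (P v.2) v.1].
Proof.
move=> wP; have oM : ~~ odd M by rewrite odd_double.
have ltM (i : 'I_M.+1) : i <= M by rewrite -ltnS.
split; apply/forallP => u; apply/implyP; rewrite inE => ch_u;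
  apply/forallP => v; apply/implyP; rewrite inE => ch_v; apply/negP => adj.
  have := chosen_indep oM wP (ltM _) (ltM _) (ltM _) (ltM _) adj.
  by rewrite ch_u ch_v.
rewrite /= /grid_edge -grid_adj_swap in adj.
have := chosen_indep oM wP (ltM _) (ltM _) (ltM _) (ltM _) adj.
by rewrite ch_u ch_v.
Qed.

Lemma card_chosen c P : wall M c P ->
  #|[set v : pgrid | chosen (P v.1) v.2]| = M.+1 * k.+1
    /\ #|[set v : pgrid | chosen (P v.2) v.1]| = M.+1 * k.+1.
Proof.
case=> bP _ _.
have colP (x : 'I_M.+1) : \sum_(y < M.+1) chosen (P x) y = k.+1.
  by apply: sum_chosen; have [] := bP x (ltn_ord x).
split; first rewrite (card_grid (fun x y => chosen (P x) y)).
  by rewrite (eq_bigr _ (fun x _ => colP x)) sum_nat_const card_ord.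
rewrite (card_grid (fun x y => chosen (P y) x)) exchange_big.
by rewrite (eq_bigr _ (fun x _ => colP x)) sum_nat_const card_ord.
Qed.

Lemma alpha_pgrid : alpha pgrid = M.+1 * k.+1.
Proof.
apply/eqP; rewrite eqn_leq; apply/andP; split.
  by rewrite -leq_double (leq_trans alpha_pgrid_le) // -doubleMr.
have oM : ~~ odd M by rewrite odd_double.
have wP := wall_tent oM (leq0n _).
rewrite -(card_chosen wP).1.
exact: leq_bigmax_cond _ (wall_indep wP).1.
Qed.

End Grid.

(** * Stability and asymptotics *)

Lemma avoid_triple k c x1 y1 x2 y2 x3 y3 (M := k.*2) :
    x1 <= M -> y1 <= M -> x2 <= M -> y2 <= M -> x3 <= M -> y3 <= M ->
    ~~ conflict M c x1 y1 x2 y2 -> ~~ conflict M c x1 y1 x3 y3 ->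
    ~~ conflict M c x2 y2 x3 y3 ->
  exists P, [/\ wall M (~~ c) P, ~~ chosen (P x1) y1, ~~ chosen (P x2) y2
    & ~~ chosen (P x3) y3].
Proof.
move=> hx1 hy1 hx2 hy2 hx3 hy3 n12 n13 n23.
have oM : ~~ odd M by rewrite odd_double.
have [w12 [b12 o12 p1 p2]] := avoid_pair hx1 hy1 hx2 hy2 n12.
have [w13 [b13 o13 q1 q3]] := avoid_pair hx1 hy1 hx3 hy3 n13.
have [w23 [b23 o23 r2 r3]] := avoid_pair hx2 hy2 hx3 hy3 n23.
have W12 := wall_tent oM b12; rewrite o12 in W12.
have W13 := wall_tent oM b13; rewrite o13 in W13.
have W23 := wall_tent oM b23; rewrite o23 in W23.
have parity x : x <= M -> odd (tent M.+1 w12 x) = odd (tent M.+1 w13 x)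
    /\ odd (tent M.+1 w12 x) = odd (tent M.+1 w23 x).
  case: W12 W13 W23 => [+ _ _] [+ _ _] [+ _ _] hx.
  by move=> /(_ x hx)[_ ->] /(_ x hx)[_ ->] /(_ x hx)[_ ->].
exists (fun x => median (tent M.+1 w12 x) (tent M.+1 w13 x) (tent M.+1 w23 x)).
split; first exact: wall_median.
- have [e1 e2] := parity _ hx1; rewrite /= (chosen_median e1 e2) //.
  by rewrite p1 q1; case: (chosen _ _).
- have [e1 e2] := parity _ hx2; rewrite /= (chosen_median e1 e2) //.
  by rewrite p2 r2; case: (chosen _ _).
- have [e1 e2] := parity _ hx3; rewrite /= (chosen_median e1 e2) //.
  by rewrite q3 r3; case: (chosen _ _).
Qed.

Lemma stable_pgrid k l : l + 3 <= #|pgrid k| -> stable (l + 3) l (pgrid k).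
Proof.
move=> le_card; split=> //; first by rewrite -addn1 leq_add2l.
move=> S cardS; set M := k.+1.*2.
have ltM (i : 'I_M.+1) : i <= M by rewrite -ltnS.
suff [A [indepA cardA small]] : exists A : {set pgrid k},
    [/\ independent A, #|A| = M.+1 * k.+1 & #|A :&: S| <= l].
  pose B : {set del_vertices S} := [set u | val u \in A].
  have indepB : independent B.
    apply/forallP=> u; apply/implyP; rewrite inE => Au.
    apply/forallP=> v; apply/implyP; rewrite inE => Av.
    by have /forallP/(_ _)/implyP/(_ Au)/forallP/(_ _)/implyP/(_ Av) := indepA.
  have cardB : #|B| = #|A :\: S|.
    rewrite -(card_imset _ val_inj); apply: eq_card => u.
    apply/imsetP/setDP => [[v + ->]|[Au Su]].
      by rewrite inE => Av; split=> //; apply: valP v.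
    by exists (Sub u Su); rewrite ?inE SubK.
  rewrite alpha_pgrid -cardA -(cardsID S A) addnC leq_add // -cardB.
  exact: leq_bigmax_cond _ indepB.
have [p [q [r [s ES]]]] : exists p q r s, enum S = [:: p, q, r & s].
  have := cardE S; rewrite cardS addn3; case: (enum S) => [|p [|q [|r s]]] //.
  by exists p, q, r, s.
have size_s : size s = l.
  by have := cardE S; rewrite cardS ES addn3 /= => -[].
suff [A [indepA cardA Ap Aq Ar]] : exists A : {set pgrid k},
    [/\ independent A, #|A| = M.+1 * k.+1, p \notin A, q \notin A & r \notin A].
  exists A; split=> //; rewrite -size_s (leq_trans _ (card_size s)) //.
  apply: subset_leq_card; apply/fintype.subsetP=> u /setIP[Au].
  rewrite -mem_enum ES !inE => /or4P[]// /eqP Eu; move: Au; rewrite Eu.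
  - by rewrite (negbTE Ap).
  - by rewrite (negbTE Aq).
  - by rewrite (negbTE Ar).
have [[[] c] [n1 n2 n3]] := conflict_free (ltM p.1) (ltM p.2) (ltM q.1)
  (ltM q.2) (ltM r.1) (ltM r.2).
- have [P [wP Ap Aq Ar]] := avoid_triple (ltM _) (ltM _) (ltM _) (ltM _)
    (ltM _) (ltM _) n1 n2 n3.
  exists [set v : pgrid k | chosen (P v.1) v.2].
  rewrite !inE; split=> //; first exact: (wall_indep wP).1.
  exact: (card_chosen wP).1.
- have [P [wP Ap Aq Ar]] := avoid_triple (ltM _) (ltM _) (ltM _) (ltM _)
    (ltM _) (ltM _) n1 n2 n3.
  exists [set v : pgrid k | chosen (P v.2) v.1].
  rewrite !inE; split=> //; first exact: (wall_indep wP).2.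
  exact: (card_chosen wP).2.
Qed.

Local Open Scope classical_set_scope.
Local Open Scope ring_scope.

Theorem theorem5 (R : realType) (l : nat) :
  exists G : nat -> sgraph,
    [/\ forall m, stable (l + 3) l (G m),
        #|G m|%N @[m --> \oo] --> \oo
      & exists C : R, \forall m \near \oo,
          `|(alpha (G m))%:R - #|G m|%:R / 2| <= C * Num.sqrt #|G m|%:R].
Proof.
(* The shift by [l] ensures at least [l + 3] vertices for every [m]. *)
exists (fun m => pgrid (m + l)); split=> [m||].
- by apply: stable_pgrid; rewrite card_pgrid; nia.
- apply/cvgnyPge => n; near=> m; rewrite card_pgrid.
  have : (n <= m)%N by near: m; exact: nbhs_infty_ge.
  by nia.
(* With side N, the independence number is N(N - 1)/2, exactly N/2 below half the order N^2. *)
- exists 2^-1; near=> m; rewrite alpha_pgrid card_pgrid natrX sqrtr_sqr natrM.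
  set k := (m + l).+1.
  have -> : k.*2.+1%:R = 2 * k%:R + 1 :> R by rewrite -addn1 natrD -mul2n natrM.
  set x : R := k%:R.
  have -> : (2 * x + 1) * x - (2 * x + 1) ^+ 2 / 2 = - (2^-1 * (2 * x + 1)).
    by field.
  by rewrite normrN normrM ger0_norm // invr_ge0.
Unshelve. all: by end_near.
Qed.
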